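(* Let $q\ge 2$ and $k\ge 2$ be integers, and let $\alpha=\alpha(k,q)$ be the unique real root outside the unit circle of the polynomial $f(x)=x^k-(q-1)\sum_{i=0}^{k-1}x^i$ (it lies in the interval $(1,q)$). Then for every $n\ge 0$ the $n$-th number of the $(q-1)$-weighted $k$-generalized Fibonacci sequence is $$F_{k,q}(n)=\left[\frac{(\alpha-1)\alpha^{n+1}}{(q+(k+1)(\alpha-q))(q-1)}\right],$$ where $[x]$ denotes the integer closest to the real number $x$.
   Context: The $(q-1)$-weighted $k$-generalized Fibonacci sequence $F_{k,q}$ is defined by $F_{k,q}(n)=q^n$ for $0\le n\le k-1$ and $F_{k,q}(n)=(q-1)\sum_{l=1}^k F_{k,q}(n-l)$ for $n\ge k$. *)

(* Defs.v *)
From HB Require Import structures.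
From mathcomp Require Import all_boot all_order all_algebra.
From mathcomp Require Import reals.
Set Implicit Arguments.
Unset Strict Implicit.
Unset Printing Implicit Defensive.
Import Order.TTheory GRing.Theory Num.Theory.

(* The values F(0), ..., F(n-1). The recursion looks back k steps, so it is
   run on the list of all previous values; [wfib_init] and [wfib_rec] below
   recover the defining equations. *)
Fixpoint wfib_prefix (k q n : nat) : seq nat :=
  if n is m.+1 then
    let s := wfib_prefix k q m in
    rcons s (if m < k then q ^ m
             else (q - 1) * \sum_(1 <= l < k.+1) nth 0 s (m - l))
  else [::].

Definition wfib (k q n : nat) : nat := nth 0 (wfib_prefix k q n.+1) n.

Lemma size_wfib_prefix k q n : size (wfib_prefix k q n) = n.
Proof. by elim: n => //= n IHn; rewrite size_rcons IHn. Qed.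

Lemma nth_wfib_prefix k q n i :
  i < n -> nth 0 (wfib_prefix k q n) i = wfib k q i.
Proof.
elim: n => // n IHn; rewrite ltnS leq_eqVlt => /predU1P[-> //|lt_in].
by rewrite /= nth_rcons size_wfib_prefix lt_in IHn.
Qed.

Lemma wfib_init k q n : n < k -> wfib k q n = q ^ n.
Proof.
by move=> lt_nk; rewrite /wfib /= nth_rcons size_wfib_prefix ltnn eqxx lt_nk.
Qed.

Lemma wfib_rec k q n : k <= n ->
  wfib k q n = (q - 1) * \sum_(1 <= l < k.+1) wfib k q (n - l).
Proof.
move=> le_kn; rewrite {1}/wfib /= nth_rcons size_wfib_prefix ltnn eqxx.
rewrite ltnNge le_kn /=; congr (_ * _); apply: eq_big_nat => l /andP[l_gt0].
rewrite ltnS => le_lk; apply: nth_wfib_prefix.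
by rewrite ltn_subrL l_gt0 (leq_trans l_gt0 (leq_trans le_lk le_kn)).
Qed.

Local Open Scope ring_scope.

Definition wfib_poly (R : realType) (k q : nat) : {poly R} :=
  'X^k - (q%:R - 1) *: \sum_(i < k) 'X^i.

(* m = [x]. Strictness makes m the only closest integer, so no convention is
   needed for ties: at a half-integer x the predicate holds for no m. *)
Definition closest_int (R : realType) (x : R) (m : int) : Prop :=
  forall j : int, j != m -> `|x - m%:~R| < `|x - j%:~R|.

(* Main.v *)
Require Import Defs.
From HB Require Import structures.
From mathcomp Require Import all_boot all_order all_algebra.
From mathcomp Require Import reals.
From mathcomp Require Import zify ring lra.
Set Implicit Arguments.
Unset Strict Implicit.
Unset Printing Implicit Defensive.
Import Order.TTheory GRing.Theory Num.Theory.
Local Open Scope ring_scope.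

(** Extended backwards by zeros (with [F(-1) = 1/(q-1)]), the sequence is, up to
    the factor [q-1] and an index shift, the impulse response [G] of the
    recurrence (this is [wfib_ext]). For a solution [u] of the recurrence, the defect
    [u(n+k) - sum_(i<k) (q-1) alpha^-(i+1) u(n+i)] is geometric of ratio [alpha];
    the constant [C] below is the one for which the defect of
    [e(n) = G(n) - C alpha^n] vanishes at [0], hence everywhere. Since
    [alpha] is a root, the weights [(q-1) alpha^-(i+1)] sum to [1]: every term of
    [e] is a convex combination of the [k] previous ones, so the bound
    [|e| < (q-1)/2] only has to be checked on the initial window. No
    information on the complex roots is needed. The window is controlled by
    [alpha > q - 1/2] and [q - alpha = (q-1)/alpha^k]. *)

(** * Recurrence solutions as weighted averages *)

Section Averaging.
Variable R : realFieldType.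

Lemma convex_rec_bounded (k : nat) (w u : nat -> R) (B : R) :
    (0 < k)%N -> (forall i, 0 < w i) -> \sum_(i < k) w i = 1 ->
    (forall n, u (n + k)%N = \sum_(i < k) w i * u (n + i)%N) ->
    (forall i, (i < k)%N -> `|u i| < B) ->
  forall n, `|u n| < B.
Proof.
move=> k_gt0 w_gt0 w_sum u_rec u_init; elim/ltn_ind => n IHn.
have [/u_init //|le_kn] := ltnP n k.
rewrite -(subnK le_kn) u_rec -[B]mul1r -w_sum mulr_suml.
apply: le_lt_trans (ler_norm_sum _ _ _) _.
apply: ltr_sum => [|i _].
  by apply/hasP; exists (Ordinal k_gt0); rewrite ?mem_index_enum.
rewrite normrM gtr0_norm ?w_gt0 // ltr_pM2l ?w_gt0 // IHn //.
by have := ltn_ord i; lia.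
Qed.

Variables (k : nat) (s a : R).
Hypotheses (k_gt0 : (0 < k)%N) (a_neq0 : a != 0).
Hypothesis a_root : a ^+ k * (s + 1 - a) = s.

Definition weight (i : nat) : R := s / a ^+ i.+1.

Definition defect (u : nat -> R) (n : nat) : R :=
  u (n + k)%N - \sum_(i < k) weight i * u (n + i)%N.

(** Consecutive windows differ only in their end terms, so subtracting two instances of the
    recurrence telescopes. *)
Lemma two_term_rec (u : nat -> R) :
    (forall n, u (n + k)%N = s * \sum_(i < k) u (n + i)%N) ->
  forall n, u (n + k).+1 = (s + 1) * u (n + k)%N - s * u n.
Proof.
move=> u_rec n.
have -> : u (n + k).+1 = u (n + k)%N + s * (u (n + k)%N - u n); last by ring.
rewrite -addSn u_rec {1}u_rec -mulrDr; congr (_ * _).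
case: k k_gt0 => // m _.
rewrite big_ord_recr big_ord_recl /= addn0 addSnnS.
under [X in _ = _ + X + _]eq_bigr do rewrite /bump /= add1n -addSnnS.
by ring.
Qed.

(** The polynomial [X^(k+1) - (s+1) X^k + s] of the telescoped recurrence factors as [X - a] times
    [X^k - sum_(i<k) (weight i) X^i]; the second factor, applied to [u], is the defect. *)
Lemma defect_rec (u : nat -> R) :
    (forall n, u (n + k)%N = s * \sum_(i < k) u (n + i)%N) ->
  forall n, defect u n.+1 = a * defect u n.
Proof.
move=> u_rec n; rewrite /defect addSn two_term_rec //.
have last_weight : weight k.-1 = s + 1 - a.
  by rewrite /weight prednK // -{1}a_root mulrAC divff ?mul1r // expf_neq0.
have shift i : weight i = a * weight i.+1.
  by rewrite /weight (exprS _ i.+1) invfM mulrCA mulVKf.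
have first_weight : a * weight 0 = s.
  by rewrite /weight expr1 mulrCA mulfV // mulr1.
case: k k_gt0 last_weight => // m _ /= last_weight.
rewrite [in LHS]big_ord_recr [in RHS]big_ord_recl /= addn0 addSnnS last_weight.
under [X in _ - (X + _)]eq_bigr do rewrite shift addSnnS -mulrA.
by rewrite -mulr_sumr mulrBr mulrDr mulrA first_weight; ring.
Qed.

Lemma defect_eq0 (u : nat -> R) :
    (forall n, u (n + k)%N = s * \sum_(i < k) u (n + i)%N) ->
    defect u 0 = 0 ->
  forall n, u (n + k)%N = \sum_(i < k) weight i * u (n + i)%N.
Proof.
move=> u_rec u0 n; apply/eqP; rewrite -subr_eq0 -/(defect u n); apply/eqP.
by elim: n => // n IHn; rewrite defect_rec // IHn mulr0.
Qed.

End Averaging.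

(** * The sequence extended backwards *)

Section Extension.
Variables (k q : nat).
Hypotheses (k_gt0 : (0 < k)%N) (q_gt0 : (0 < q)%N).

(* [wfib_ext m] stands for [(q - 1) * F(m - k)], where [F(-1) = 1 / (q - 1)] and
   [F(-k) = ... = F(-2) = 0]. *)
Definition wfib_ext (m : nat) : nat :=
  if (m < k)%N then (m == k.-1) : nat else ((q - 1) * wfib k q (m - k))%N.

Lemma wfib_ext_shift n : wfib_ext (n + k) = ((q - 1) * wfib k q n)%N.
Proof. by rewrite /wfib_ext ltnNge leq_addl addnK. Qed.

Lemma wfib_window n : wfib k q n = (\sum_(i < k) wfib_ext (n + i))%N.
Proof.
have [lt_nk|le_kn] := ltnP n k; last first.
  rewrite wfib_rec // big_distrr /= big_add1 /= big_mkord.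
  rewrite (reindex_inj rev_ord_inj) /=; apply: eq_bigr => i _.
  rewrite -[in RHS](subnK le_kn) addnAC wfib_ext_shift; congr (_ * wfib _ _ _)%N.
  by have := ltn_ord i; lia.
elim: n lt_nk => [|n IHn] lt_nk.
  rewrite wfib_init // -(prednK k_gt0) big_ord_recr /= big1 => [|i _].
    by rewrite /wfib_ext prednK // leqnn eqxx.
  by rewrite /wfib_ext; have := ltn_ord i; case: ifP; lia.
have {}IHn := IHn (ltnW lt_nk).
(* Sliding the window drops a zero, because [n.+1 < k] excludes [n = k.-1], and gains [(q-1) q^n];
   so the sum grows from [q^n] to [q^(n+1)]. *)
have : (wfib_ext n + \sum_(i < k) wfib_ext (n.+1 + i) =
        \sum_(i < k) wfib_ext (n + i) + wfib_ext (n + k))%N.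
  transitivity (\sum_(i < k.+1) wfib_ext (n + i))%N;
    last by rewrite big_ord_recr.
  rewrite big_ord_recl addn0; congr addn.
  by apply: eq_bigr => i _; rewrite addSnnS.
rewrite -IHn wfib_ext_shift !wfib_init ?(ltnW lt_nk) // expnS {1}/wfib_ext.
by rewrite (ltnW lt_nk); nia.
Qed.

Lemma wfib_ext_rec n :
  wfib_ext (n + k) = ((q - 1) * \sum_(i < k) wfib_ext (n + i))%N.
Proof. by rewrite wfib_ext_shift wfib_window. Qed.

End Extension.

(** * The root outside the unit circle *)

Section Root.
Variables (R : realType) (q k : nat).
Hypotheses (hq : (2 <= q)%N) (hk : (2 <= k)%N).
Local Notation Q := (q%:R : R).

Lemma horner_wfib_poly (x : R) :
  (wfib_poly R k q).[x] = x ^+ k - (Q - 1) * \sum_(i < k) x ^+ i.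
Proof.
rewrite /wfib_poly !hornerE horner_sum; congr (_ - _ * _).
by apply: eq_bigr => i _; rewrite hornerXn.
Qed.

Lemma wfib_poly_mulX1 (x : R) :
  (x - 1) * (wfib_poly R k q).[x] = (Q - 1) - x ^+ k * (Q - x).
Proof.
rewrite horner_wfib_poly mulrBr (mulrCA _ (Q - 1)) -subrX1; ring.
Qed.

Let Q_ge2 : 2 <= Q. Proof. by rewrite ler_nat. Qed.

Lemma wfib_poly_root_eq (x : R) :
  root (wfib_poly R k q) x -> x ^+ k * (Q - x) = Q - 1.
Proof.
move/rootP=> px0; have := wfib_poly_mulX1 x; rewrite px0 mulr0; lra.
Qed.

Lemma wfib_poly_root_bounds (x : R) :
  root (wfib_poly R k q) x -> 1 < `|x| -> 1 < x < Q.
Proof.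
move=> /wfib_poly_root_eq x_eq; have Q2 := Q_ge2.
have [x_le0 x_gt1|x_gt0 x_gt1] := lerP x 0; last first.
  have xk_gt0 : 0 < x ^+ k by rewrite exprn_gt0.
  rewrite gtr0_norm // in x_gt1.
  rewrite x_gt1 /= -subr_gt0 -(pmulr_rgt0 _ xk_gt0) x_eq; lra.
(* A nonpositive root is impossible: in absolute value [x^k (Q - x)] would exceed [Q], yet it equals
   [Q - 1]. *)
have xk_gt1 : 1 < `|x| ^+ k by rewrite exprn_egt1 //; lia.
have Qx_gt0 : 0 < Q - x by lra.
move: (congr1 Num.norm x_eq); rewrite normrM normrX (gtr0_norm Qx_gt0).
rewrite (@ger0_norm _ (Q - 1)); last by lra.
have : Q - x < `|x| ^+ k * (Q - x) by rewrite ltr_pMl.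
by lra.
Qed.

(** A root satisfies [1 = (Q-1) sum_(i<k) x^(i-k)], whose right side is strictly decreasing for
    positive [x]. The proof clears denominators and compares termwise. *)
Lemma wfib_poly_root_uniq (x y : R) :
  root (wfib_poly R k q) x -> root (wfib_poly R k q) y -> 1 < x -> 1 < y ->
  x = y.
Proof.
wlog lt_xy : x y / x < y => [wlog_hyp|].
  move=> *; have [?|?|//] := ltgtP x y; first exact: wlog_hyp.
  by apply/esym/wlog_hyp.
move=> /rootP + /rootP; rewrite !horner_wfib_poly => /subr0_eq x_eq /subr0_eq y_eq.
move=> x_gt1 y_gt1; have Q2 := Q_ge2.
have : x ^+ k * y ^+ k < x ^+ k * y ^+ k; last by rewrite ltxx.
rewrite {1}y_eq {2}x_eq mulrCA -mulrA ltr_pM2l; last by lra.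
rewrite mulr_sumr mulr_suml; apply: ltr_sum => [|i _].
  by apply/hasP; exists (Ordinal (ltnW hk)); rewrite ?mem_index_enum.
have le_ik := ltnW (ltn_ord i).
have split_exp z : z ^+ k = z ^+ i * z ^+ (k - i) :> R.
  by rewrite -exprD subnKC.
rewrite !split_exp mulrAC mulrA ltr_pM2l.
  by rewrite ltrXn2r ?nnegrE // ?subn_eq0 -?ltnNge //; lra.
by apply: mulr_gt0; apply: exprn_gt0; lra.
Qed.

(** Intermediate values on [[b, Q]]: after multiplication by [x - 1], the value at [Q] is [Q - 1],
    and the value at [b] is at most [Q - 1 - b^2/2], which is negative as
    [b^2 - 2(Q-1) = (Q - 3/2)^2]. *)
Lemma wfib_poly_root_exists :
  exists2 x : R, root (wfib_poly R k q) x & Q - 2^-1 < x.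
Proof.
have Q2 := Q_ge2.
set b : R := Q - 2^-1; have b_gt1 : 1 < b by rewrite /b; lra.
have b2 : b ^+ 2 <= b ^+ k by apply: ler_weXn2l; rewrite // ltW.
have fb_lt0 : (wfib_poly R k q).[b] < 0.
  rewrite -(pmulr_rlt0 _ (_ : 0 < b - 1)) ?subr_gt0 // wfib_poly_mulX1.
  have -> : Q - b = 2^-1 by rewrite /b; lra.
  have : b ^+ 2 * 2^-1 <= b ^+ k * 2^-1 by rewrite ler_wpM2r //; lra.
  rewrite /b in b2 *; nra.
have fQ_gt0 : 0 < (wfib_poly R k q).[Q].
  rewrite -(pmulr_rgt0 _ (_ : 0 < Q - 1)); last by lra.
  by rewrite wfib_poly_mulX1 subrr mulr0; lra.
have [||x /andP[le_bx _] px0] := @poly_ivt R (wfib_poly R k q) b Q.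
- by rewrite /b; lra.
- by rewrite !ltW.
exists x => //; rewrite lt_neqAle le_bx andbT.
by apply: contraTneq px0 => <-; rewrite rootE lt_eqF.
Qed.

Lemma wfib_poly_root_gt (x : R) :
  root (wfib_poly R k q) x -> 1 < x -> Q - 2^-1 < x.
Proof.
move=> px0 x_gt1; have [y py0 y_gt] := wfib_poly_root_exists.
rewrite (wfib_poly_root_uniq px0 py0) //; apply: lt_trans y_gt.
have := Q_ge2; lra.
Qed.

(** * The error bound *)

Section Estimates.
Variable a : R.
Hypotheses (a_root : root (wfib_poly R k q) a) (a_gt1 : 1 < a).
Let d : R := Q - a.
(** The factor [q + (k+1)(alpha - q)] of the formula's denominator is [a - x]. *)
Let x : R := k%:R * d.

Let a_gt : Q - 2^-1 < a. Proof. exact: wfib_poly_root_gt. Qed.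

Let a_ltQ : a < Q.
Proof.
by have /andP[] :=
  wfib_poly_root_bounds a_root (lt_le_trans a_gt1 (ler_norm a)).
Qed.

Let d_gt0 : 0 < d. Proof. by rewrite subr_gt0. Qed.

Let a_gt0 : 0 < a. Proof. exact: lt_trans a_gt1. Qed.

Let ak_gt0 : 0 < a ^+ k. Proof. exact: exprn_gt0. Qed.

Let a_eq : a ^+ k * d = Q - 1. Proof. exact: wfib_poly_root_eq. Qed.

(** Multiplied by [a^k], this becomes [k (Q-1) < a^k], which follows by induction from [k = 2] since
    [a > 3/2]. *)
Lemma kd_lt1 : x < 1.
Proof.
rewrite -(ltr_pM2l ak_gt0) mulrCA a_eq mulr1.
have Q2 := Q_ge2.
elim: k hk => // m IHm; rewrite leq_eqVlt => /predU1P[<-|m_ge2].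
  by have := a_gt; nra.
have {}IHm := IHm m_ge2.
have m2 : 2 <= m%:R :> R by rewrite ler_nat.
rewrite exprS -natr1; have A := a_gt.
have a0 := a_gt0.
apply: (le_lt_trans (y := a * (m%:R * (Q - 1)))); last by rewrite ltr_pM2l.
rewrite mulrA ler_pM2r; last by lra.
nra.
Qed.

Lemma kd_gt_d : d < x.
Proof. by rewrite ltr_pMl ?ltr1n. Qed.

Lemma den_gt0 : 0 < a - x.
Proof. have := kd_lt1; have := a_gt1; lra. Qed.

Lemma succ_mul_lt_expr : q = 2 -> (k%:R + 1) * a < 2 * a ^+ k.
Proof.
move=> q2; have A : 3 < 2 * a by move: a_gt; rewrite q2; lra.
have a0 := a_gt0.
elim: k hk => // m IHm; rewrite leq_eqVlt => /predU1P[<-|m_ge2]; first by nra.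
have {}IHm := IHm m_ge2.
have m2 : 2 <= m%:R :> R by rewrite ler_nat.
rewrite exprS -natr1 mulrCA; apply: (le_lt_trans (y := a * ((m%:R + 1) * a))).
  by rewrite [leRHS]mulrC ler_pM2r //; nra.
by rewrite ltr_pM2l.
Qed.

(** This says [C a^(k-2) < (Q-1)/2], the worst case of the initial window before index [k-1]. For
    [q > 2], [a - 1 < a - x] suffices; for [q = 2] it reduces to [(x + d) a < 2], which is
    [succ_mul_lt_expr] times [d]. *)
Lemma gap_low : 2 * (a - 1) < (Q - 1) * (a * (a - x)).
Proof.
have x1 := kd_lt1; have den0 := den_gt0.
have [q_gt2|] := ltnP 2 q.
  have Q3 : 3 <= Q by rewrite ler_nat.
  have a1 : a - 1 < a * (a - x).
    apply: (lt_trans (y := a - x)); first by lra.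
    by rewrite ltr_pMl.
  have a2 : 0 <= (Q - 3) * (a * (a - x)).
    by rewrite mulr_ge0 ?subr_ge0 // ltW // mulr_gt0.
  lra.
rewrite leq_eqVlt ltnNge hq orbF => /eqP q2.
have xd : a = 2 - d by rewrite /d q2; ring.
have akd : a ^+ k * d = 1 by rewrite a_eq q2; ring.
have : ((k%:R + 1) * a) * d < (2 * a ^+ k) * d.
  by rewrite ltr_pM2r // succ_mul_lt_expr.
rewrite -(mulrA 2) akd mulr1 q2 mulrAC mulrDl mul1r -/x.
have -> : a * (a - x) = 2 * a - (x + d) * a by rewrite xd; ring.
lra.
Qed.

(** This bounds the error at index [k-1]. It is tightest at [q = 2], where the two sides differ by
    [x - d]. *)
Lemma gap_last : 2 * (1 - x) < (Q - 1) * (a - x).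
Proof.
have x1 := kd_lt1; have den0 := den_gt0; have xd := kd_gt_d.
have Q2 := Q_ge2; move: xd; rewrite /d; nra.
Qed.

(** Here [C a^(n+k)] is [Q - 1] times the real number to be rounded. *)
Let C : R := a * (a - 1) / (a ^+ k * (a - x)).

Let err (m : nat) : R := (wfib_ext k q m)%:R - C * a ^+ m.

Let k_gt0 : (0 < k)%N. Proof. exact: ltnW. Qed.
Let q_gt0 : (0 < q)%N. Proof. exact: ltnW. Qed.
Let natQ1 : (q - 1)%N%:R = Q - 1. Proof. by rewrite natrB. Qed.
Let a_neq0 : a != 0. Proof. by rewrite gt_eqF // (lt_trans ltr01). Qed.

Lemma err_rec n : err (n + k)%N = (Q - 1) * \sum_(i < k) err (n + i)%N.
Proof.
rewrite /err wfib_ext_rec // natrM natQ1 sumrB mulrBr natr_sum -mulr_sumr.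
congr (_ - _); rewrite exprD.
under eq_bigr do rewrite exprD.
rewrite -mulr_sumr.
move/rootP: a_root; rewrite horner_wfib_poly => /subr0_eq ->; ring.
Qed.

(** The impulse contributes only [weight k.-1 = d], while each [weight i] times [a^i] is [(Q-1)/a].
    The defect is thus [(Q - 1 - d) - C (a^k - k (Q-1)/a)], where the last bracket is
    [a^k (a - x)/a]. *)
Lemma err_defect0 : defect k (Q - 1) a err 0 = 0.
Proof.
rewrite /defect; under eq_bigr do rewrite /err mulrBr.
rewrite sumrB.
have -> : \sum_(i < k) weight (Q - 1) a i * (wfib_ext k q (0 + i))%:R = d.
  have lt_k : (k.-1 < k)%N by rewrite prednK.
  rewrite (bigD1 (Ordinal lt_k)) //= big1 => [|i ne_i].
    rewrite /wfib_ext add0n lt_k eqxx mulr1 addr0 /weight prednK //.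
    by rewrite -a_eq mulrAC divff ?mul1r // gt_eqF.
  by rewrite /wfib_ext add0n ltn_ord -val_eqE /= in ne_i *;
    rewrite (negPf ne_i) mulr0.
have -> : \sum_(i < k) weight (Q - 1) a i * (C * a ^+ (0 + i)) =
    C * (k%:R * (Q - 1) / a).
  rewrite (eq_bigr (fun=> C * ((Q - 1) / a))) => [|i _].
    by rewrite sumr_const card_ord -mulr_natl; ring.
  by rewrite /weight exprSr; field; rewrite a_neq0 expf_neq0.
rewrite /err wfib_ext_shift natrM wfib_init // mulr1 natQ1 -{2}a_eq /C add0n.
rewrite /x /d; have := den_gt0; have := ak_gt0; rewrite /x /d => ? ?.
by field; rewrite a_neq0 !gt_eqF.
Qed.

Lemma err_init m : (m < k)%N -> `|err m| < (Q - 1) / 2.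
Proof.
have den0 := den_gt0; have x1 := kd_lt1; have a0 := a_gt0.
move=> lt_mk; rewrite /err /wfib_ext lt_mk ltr_pdivlMr //.
have [->|ne_m] := eqVneq m k.-1.
  have -> : 1%:R - C * a ^+ k.-1 = (1 - x) / (a - x).
    rewrite /C -[in a ^+ k](prednK k_gt0) exprS.
    by field; rewrite a_neq0 !gt_eqF ?exprn_gt0.
  rewrite gtr0_norm; last by apply: divr_gt0; rewrite // subr_gt0.
  by rewrite mulrAC ltr_pdivrMr // mulrC gap_last.
rewrite sub0r normrN gtr0_norm; last first.
  by rewrite mulr_gt0 ?exprn_gt0 // divr_gt0 ?mulr_gt0 // subr_gt0.
have le_am : a ^+ m * a ^+ 2 <= a ^+ k.
  by rewrite -exprD ler_weXn2l ?ltW //; lia.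
have -> : C * a ^+ m * 2 =
    (2 * (a - 1)) * (a ^+ m * a ^+ 2) / (a ^+ k * (a * (a - x))).
  by rewrite /C; field; rewrite a_neq0 !gt_eqF.
rewrite ltr_pdivrMr ?mulr_gt0 //.
apply: (le_lt_trans (y := 2 * (a - 1) * a ^+ k)).
  by rewrite ler_pM2l //; move: a_gt1; lra.
by rewrite mulrCA [ltRHS]mulrC ltr_pM2r // gap_low.
Qed.

Lemma err_lt n : `|err n| < (Q - 1) / 2.
Proof.
have Q2 := Q_ge2; have a0 := a_gt0.
apply: (convex_rec_bounded (w := weight (Q - 1) a)) k_gt0 _ _ _ err_init n.
- by move=> i; rewrite divr_gt0 ?exprn_gt0 //; lra.
(* The weights sum to [1]: this is the root equation divided by [a^k], with the summation
   reversed. *)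
- move/rootP: a_root; rewrite horner_wfib_poly => /subr0_eq ak.
  have ak_neq0 : a ^+ k != 0 by rewrite gt_eqF.
  apply: (mulfI ak_neq0); rewrite mulr1 {2}ak !mulr_sumr.
  rewrite (reindex_inj rev_ord_inj) /=; apply: eq_bigr => i _.
  have lt_ik := ltn_ord i.
  have {1}-> : a ^+ k = a ^+ i * a ^+ (k - i.+1).+1.
    by rewrite -exprD; congr (_ ^+ _); lia.
  by rewrite /weight; field; rewrite expf_neq0.
- by apply: defect_eq0 err_rec err_defect0 => //; rewrite subrK.
Qed.

Lemma wfib_approx n :
  `|(a - 1) * a ^+ n.+1 / ((Q + (k%:R + 1) * (a - Q)) * (Q - 1))
    - (wfib k q n)%:R| < 2^-1.
Proof.
have Q2 := Q_ge2; have Q1_gt0 : 0 < Q - 1 by lra.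
have den0 := den_gt0.
rewrite distrC -(ltr_pM2l Q1_gt0) -{1}(gtr0_norm Q1_gt0) -normrM.
suff -> : (Q - 1) * ((wfib k q n)%:R
    - (a - 1) * a ^+ n.+1 / ((Q + (k%:R + 1) * (a - Q)) * (Q - 1)))
    = err (n + k)%N by exact: err_lt.
have -> : Q + (k%:R + 1) * (a - Q) = a - x by rewrite /x /d; ring.
rewrite /err wfib_ext_shift natrM natQ1 /C exprD exprS.
by field; rewrite !gt_eqF.
Qed.

End Estimates.

End Root.

(** * Rounding and conclusion *)

Lemma closest_int_of_lt_half (R : realType) (x : R) (m : int) :
  `|x - m%:~R| < 2^-1 -> closest_int x m.
Proof.
move=> xm j ne_jm; apply: (lt_le_trans xm).
have : 1 <= `|m%:~R - j%:~R : R|.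
  rewrite -intrB -intr_norm -[1]/(1%:~R) ler_int.
  by rewrite -gtz0_ge1 normr_gt0 subr_eq0 eq_sym.
have := ler_distD x (m%:~R : R) j%:~R; rewrite (distrC m%:~R x).
lra.
Qed.

Theorem mainTheorem6 (R : realType) (q k : nat)
    (hq : (2 <= q)%N) (hk : (2 <= k)%N) :
  (exists! alpha : R, root (wfib_poly R k q) alpha /\ 1 < `|alpha|) /\
  (forall alpha : R, root (wfib_poly R k q) alpha -> 1 < `|alpha| ->
     1 < alpha < q%:R /\
     forall n : nat,
       closest_int
         ((alpha - 1) * alpha ^+ n.+1 /
            ((q%:R + (k%:R + 1) * (alpha - q%:R)) * (q%:R - 1)))
         (wfib k q n)%:Z).
Proof.
split.
  have [x x_root x_gt] := wfib_poly_root_exists R hq hk.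
  have x_gt1 : 1 < x.
    have : 2 <= q%:R :> R by rewrite ler_nat.
    lra.
  exists x; split; first by split=> //; apply: lt_le_trans (ler_norm _).
  move=> y [y_root /(wfib_poly_root_bounds hq hk y_root)/andP[y_gt1 _]].
  exact: wfib_poly_root_uniq y_root x_gt1 y_gt1.
move=> a a_root a_out.
have /andP[a_gt1 a_ltq] := wfib_poly_root_bounds hq hk a_root a_out.
split=> [|n]; first by rewrite a_gt1.
by apply: closest_int_of_lt_half; apply: wfib_approx.
Qed.
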